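(* For every positive integer $k$ there exists a positive integer $f(k)$ such that every strongly $4k$-connected tournament $T$ with minimum out-degree $\delta^+(T) \ge f(k)$ is $k$-linked.
   Context: A tournament is a (finite) directed graph in which, for every pair of distinct vertices $x,y$, exactly one of the directed edges $xy$, $yx$ is present. A directed graph is strongly connected if for any pair of distinct vertices $x$ and $y$ there is a directed path from $x$ to $y$; it is strongly $m$-connected if it remains strongly connected upon removal of any set of at most $m-1$ vertices. A directed graph $D$ is $k$-linked if for any two disjoint sets of vertices $\{x_1,\ldots,x_k\}$ and $\{y_1,\ldots,y_k\}$ (each consisting of $k$ distinct vertices) there are pairwise vertex disjoint directed paths $P_1,\ldots,P_k$ such that $P_i$ has initial vertex $x_i$ and terminal vertex $y_i$ for every $i\in\{1,\ldots,k\}$. $\delta^+(T)$ denotes the minimum out-degree of $T$. *)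

(* Defs.v *)
From mathcomp Require Import all_boot.

Set Implicit Arguments.
Unset Strict Implicit.
Unset Printing Implicit Defensive.

(* A finite directed graph is a relation e on a finType of vertices;
   e x y means that the edge xy is present. *)

Definition tournament (T : finType) (e : rel T) : Prop :=
  irreflexive e /\ forall x y : T, x != y -> e x y (+) e y x.

(* The vertices of the directed path are those of x :: p, without repetition. *)
Definition dipath (T : finType) (e : rel T) (x y : T) (p : seq T) : bool :=
  [&& path e x p, last x p == y & uniq (x :: p)].

Definition strongly_connected (T : finType) (e : rel T) : Prop :=
  forall x y : T, x != y -> exists p : seq T, dipath e x y p.

Definition del_vertices (T : finType) (e : rel T) (S : {set T}) :
    rel {x : T | x \notin S} :=
  fun x y => e (val x) (val y).

Definition strongly_mconnected (m : nat) (T : finType) (e : rel T) : Prop :=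
  forall S : {set T}, #|S| < m -> strongly_connected (@del_vertices T e S).

Definition outdegree (T : finType) (e : rel T) (x : T) : nat :=
  #|[set y | e x y]|.

(* No out-degree exceeds #|T|, so the default value #|T| does not affect the
   minimum when T is nonempty; it gives 0 when T is empty. *)
Definition min_outdegree (T : finType) (e : rel T) : nat :=
  \big[minn/#|T|]_(x : T) outdegree e x.

Definition linked (k : nat) (T : finType) (e : rel T) : Prop :=
  forall x y : 'I_k -> T,
    injective x -> injective y -> (forall i j, x i != y j) ->
    exists P : 'I_k -> seq T,
      (forall i, dipath e (x i) (y i) (P i)) /\
      (forall i j, i != j -> [disjoint x i :: P i & x j :: P j]).

(* Main.v *)
Require Import Defs.
From mathcomp Require Import all_boot.
From mathcomp Require Import zify.

Set Implicit Arguments.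
Unset Strict Implicit.
Unset Printing Implicit Defensive.

(** Large minimum out-degree yields a bounded set S of branch vertices of a
    subdivided complete digraph such that every vertex x reaches, by a path
    x -> w -> b avoiding any few prescribed vertices, some b with many
    out-neighbours in S. Choose such paths, pairwise disjoint, from all the x_i;
    they occupy at most 3k vertices. Discard these and the few branch vertices
    whose subdivided edges they spoil. The rest is still strongly k-connected,
    so Menger's theorem gives k disjoint paths Q_i from branch vertices s_i to
    the y_i. If these use as few edges outside the subdivision as possible, then
    no subdivided edge issuing from an unused branch vertex meets any Q_j, for Q_j
    could be rerouted along it. So b_i moves to an unused out-neighbour a_i in S,
    follows the subdivided edge from a_i to s_i, and then Q_i. *)

(** * Hall and Menger *)

(* Rado's argument: from a set with two elements x and y one of the two can be
   deleted without violating Hall's condition. *)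
Lemma hall (I T : finType) (G : I -> {set T}) :
  (forall W : {set I}, #|W| <= #|\bigcup_(i in W) G i|) ->
  exists2 h : I -> T, injective h & forall i, h i \in G i.
Proof.
have [n] := ubnP (\sum_i #|G i|); elim: n G => // n IHn G leGn hallG.
have [[i /card_gt1P[x [y [xGi yGi neq_xy]]]]|card_le1] :
    (exists i, 1 < #|G i|) \/ (forall i, #|G i| <= 1).
- case: (pickP (fun i => 1 < #|G i|)) => [i|all_le]; first by left; exists i.
  by right=> i; rewrite leqNgt all_le.
- pose G' z j := if j == i then G i :\ z else G j.
  (* If deleting [z] from [G i] breaks Hall's condition, the violating set contains [i], all other
     sets being unchanged. *)
  have shrink z : z \in G i ->
      (exists2 h : I -> T, injective h & forall j, h j \in G j) \/
      exists2 W : {set I}, i \in W & #|\bigcup_(j in W) G' z j| < #|W|.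
    move=> zGi.
    case: (pickP (fun W : {set I} => #|\bigcup_(j in W) G' z j| < #|W|)).
      move=> W ltW; right; exists W => //; apply: contraLR ltW => iNW.
      rewrite -leqNgt (eq_bigr G) // => j jW; rewrite /G'.
      by case: eqP jW iNW => // -> ->.
    move=> noW; left.
    have [||h inj_h hG'] := IHn (G' z).
    + rewrite -ltnS; apply: leq_trans leGn; rewrite ltnS (bigD1 i) //= [ltnRHS](bigD1 i) //=.
      rewrite /G' eqxx -addSn leq_add //; first by rewrite (cardsD1 z (G i)) zGi.
      by apply: leq_sum => j /negPf ->.
    + by move=> W; rewrite leqNgt noW.
    + exists h => // j; have := hG' j; rewrite /G'.
      by case: eqP => // ->; rewrite inE => /andP[].
  (* Since [x != y], [U1 :|: U2] covers the neighbourhood of [W1 :|: W2], and [U1 :&: U2] that of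
     [(W1 :&: W2) :\ i]. Hence [#|U1| + #|U2|] is at least [#|W1| + #|W2| - 1], one more than the
     two violations allow. *)
  have [//|[W1 iW1 lt1]] := shrink x xGi; have [//|[W2 iW2 lt2]] := shrink y yGi.
  set U1 := \bigcup_(j in W1) _ in lt1; set U2 := \bigcup_(j in W2) _ in lt2.
  have sub_cup : \bigcup_(j in W1 :|: W2) G j \subset U1 :|: U2.
    apply/bigcupsP => j jW; apply/subsetP => z zGj.
    have [ji|ji] := eqVneq j i; last first.
      case/setUP: jW => jW; apply/setUP; [left|right]; apply/bigcupP;
        by exists j; rewrite // /G' (negPf ji).
    have [zx|zx] := eqVneq z x.
      apply/setUP; right; apply/bigcupP; exists i; rewrite // /G' eqxx !inE.
      by rewrite zx neq_xy xGi.
    apply/setUP; left; apply/bigcupP; exists i; rewrite // /G' eqxx !inE.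
    by rewrite zx -ji.
  have sub_cap : \bigcup_(j in (W1 :&: W2) :\ i) G j \subset U1 :&: U2.
    apply/bigcupsP => j; rewrite !inE => /and3P[/negPf ji jW1 jW2].
    by apply/subsetP => z zGj; rewrite inE; apply/andP; split; apply/bigcupP;
      exists j; rewrite // /G' ji.
  have := leq_trans (hallG _) (subset_leq_card sub_cup).
  have := leq_trans (hallG _) (subset_leq_card sub_cap).
  have := cardsUI U1 U2; have := cardsUI W1 W2.
  have := cardsD1 i (W1 :&: W2); rewrite inE iW1 iW2.
  move: lt1 lt2; lia.
have card1 i : #|G i| == 1.
  by rewrite eqn_leq card_le1; have := hallG [set i]; rewrite cards1 big_set1.
have mem i : {z | z \in G i}.
  case: (pickP (mem (G i))) => [z zG|G0]; first by exists z.
  by exfalso; move: (card1 i); rewrite (eq_card0 G0).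
exists (fun i => sval (mem i)) => [i j /= eq_ij|i]; last exact: (svalP (mem i)).
have Gi i' : G i' = [set sval (mem i')].
  have /cards1P[z Gz] := card1 i'; have /= := svalP (mem i').
  by case: (mem i') => u /= uG _; move: uG; rewrite Gz => /set1P ->.
apply/eqP; apply: contraT => neq_ij; have := hallG [set i; j].
by rewrite cards2 neq_ij bigcup_setU !big_set1 (Gi i) (Gi j) eq_ij setUid cards1.
Qed.

(** For a nonempty [W], a single [G i] with [i] in [W] already has [#|I|] elements, so Hall's
    condition holds. *)
Lemma distinct_representatives (I T : finType) (G : I -> {set T}) :
  (forall i, #|I| <= #|G i|) ->
  exists2 h : I -> T, injective h & forall i, h i \in G i.
Proof.
move=> leG; apply: hall => W; have [->|[i iW]] := set_0Vmem W; first by rewrite cards0.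
by rewrite (leq_trans (max_card _)) // (leq_trans (leG i)) // subset_leq_card // bigcup_sup.
Qed.

Definition linkage (T : finType) (e : rel T) (S : {set T}) (k : nat) (y s : 'I_k -> T)
    (p : 'I_k -> seq T) : Prop :=
  [/\ forall i, s i \in S, forall i, dipath e (s i) (y i) (p i)
    & forall i j, i != j -> [disjoint s i :: p i & s j :: p j]].

(* Hall's theorem, applied to the sets of in-neighbours (and loops), provides an
   injective predecessor map defined off A and avoiding the y_i; iterating it
   from the y_i traces k disjoint paths back to A. *)
Lemma menger (T : finType) (e : rel T) (A : {set T}) (k : nat) (y : 'I_k -> T) :
  injective y ->
  (forall Z : {set T}, #|Z| < k ->
    exists a p, [/\ a \in A, path e a p, last a p \in codom y
                  & all [predC Z] (a :: p)]) ->
  exists s p, linkage e A y s p.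
Proof.
move=> inj_y sep; pose Y := [set y i | i : 'I_k].
have cardY : #|Y| = k by rewrite card_imset // card_ord.
pose G (v : {v : T | v \notin A}) := [set u | (u == val v) || e u (val v)] :\: Y.
have [W0|h inj_h hG] := @hall _ _ G.
  pose W := val @: W0; rewrite -(card_imset _ val_inj) -/W.
  have -> : \bigcup_(v in W0) G v = [set u | [exists v in W, (u == v) || e u v]] :\: Y.
    apply/setP=> u; apply/bigcupP/setDP.
      case=> v vW; rewrite !inE => /andP[uY uv]; split=> //; apply/existsP.
      by exists (val v); rewrite imset_f.
    rewrite inE; case=> /existsP[_ /andP[/imsetP[v vW ->] uv]] uY.
    by exists v => //; rewrite !inE uY.
  pose bd := [set u | (u \notin W) && [exists v in W, e u v]].
  have -> : [set u | [exists v in W, (u == v) || e u v]] = W :|: bd.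
    apply/setP=> u; rewrite !inE; case: (boolP (u \in W)) => /= uW.
      by apply/existsP; exists u; rewrite uW eqxx.
    apply/existsP/existsP => -[v /andP[vW]].
      by case: eqP uW => [->|_ _ uv]; [rewrite vW|exists v; rewrite vW].
    by move=> uv; exists v; rewrite vW uv orbT.
  (* This set meets every path from [A] to a [y i]: as [W] misses [A], the path either enters [W]
     from [bd], or stays off [W] and ends in [Y :\: W]. *)
  have leZ : k <= #|bd :|: (Y :\: W)|.
    rewrite leqNgt; apply/negP => /sep[a [p [aA]]] pth lst aNp.
    have aW : a \notin W.
      by apply/imsetP => -[v vW av]; move: (valP v); rewrite -av aA.
    have {lst} lY : last a p \in Y.
      by case/codomP: lst => i ->; rewrite imset_f.
    elim: p a pth aNp lY {aA} aW => [|b p IHp] a /=.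
      rewrite !inE => _ /andP[]; case: (a \in W) => //; rewrite !negb_or => /andP[_] /=.
      by case: (a \in Y).
    case/andP=> eab pth /andP[aZ bp] lY aW; apply: IHp pth bp lY _.
    apply: contra aZ => bW; rewrite !inE aW /=; apply/orP; left.
    by apply/existsP; exists b; rewrite bW.
  have disj : bd :&: W = set0.
    by apply/setP=> u; rewrite !inE; case: (u \in W); rewrite ?andbF.
  have cW := cardsID Y W; have cY := cardsID W Y.
  (* Points of [bd] in [Y] are off [W], so they are counted in [Y :\: W]. Thus [#|bd :\: Y|] is at
     least [#|Y :&: W|], which gives Hall's condition. *)
  have : #|bd :|: (Y :\: W)| <= #|bd :\: Y| + #|Y :\: W|.
    rewrite -cardsUI (leq_trans _ (leq_addr _ _)) // subset_leq_card //.
    apply/subsetP => u; rewrite !inE; case: (boolP (u \in Y)); case: (u \in W); by rewrite ?orbT.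
  have -> : (W :|: bd) :\: Y = (W :\: Y) :|: (bd :\: Y) by rewrite setDUl.
  have := cardsUI (W :\: Y) (bd :\: Y).
  have -> : (W :\: Y) :&: (bd :\: Y) = set0.
    apply/setP=> u; rewrite !inE; case: (u \in W) => //=; by rewrite !andbF.
  rewrite cards0; move: cW cY; rewrite [Y :&: W]setIC cardY; lia.
(* Off [A] this is the predecessor map; its default value on [A] is harmless, since the traces stop
   on reaching [A]. *)
pose f u := if insub u is Some v then h v else u.
have fE u (uA : u \notin A) : f u = h (exist _ u uA) by rewrite /f insubT.
have inj_f u v : u \notin A -> v \notin A -> f u = f v -> u = v.
  by move=> uA vA; rewrite !fE => /inj_h [].
have fY u : u \notin A -> f u \notin Y.
  by move=> uA; rewrite fE; have := hG (exist _ u uA); rewrite inE => /andP[].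
(* Injectivity cancels common steps until one trace is back at its start. The other is then at its
   start too, because the values of [f] off [A] avoid [Y]. *)
have meet a b i j : (forall c, c < a -> iter c f (y i) \notin A) ->
    (forall c, c < b -> iter c f (y j) \notin A) ->
    iter a f (y i) = iter b f (y j) -> i = j /\ a = b.
  elim: a b => [|a IHa] [|b] ia jb /=.
  - by move=> /inj_y.
  - by move=> eq_y; have := fY _ (jb b (ltnSn _)); rewrite -eq_y imset_f.
  - by move=> eq_y; have := fY _ (ia a (ltnSn _)); rewrite eq_y imset_f.
  - move/inj_f => /(_ (ia _ (ltnSn _)) (jb _ (ltnSn _))) /IHa [] //.
    + by move=> c /ltnW; apply: ia.
    + by move=> c /ltnW; apply: jb.
    + by move=> -> ->.
have hit i : exists n, iter n f (y i) \in A.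
  case: (pickP (fun n : 'I_#|T|.+1 => iter n f (y i) \in A)) => [n nA|noA].
    by exists n.
  have /injectiveP : injective (fun n : 'I_#|T|.+1 => iter n f (y i)).
    move=> a b /meet[] // => [c lt|c lt|_ /val_inj //].
      by have /= -> := noA (Ordinal (ltn_trans lt (ltn_ord a))).
    by have /= -> := noA (Ordinal (ltn_trans lt (ltn_ord b))).
  by move/injectiveP/leq_card; rewrite card_ord ltnn.
pose n i := ex_minn (hit i).
have nA i : iter (n i) f (y i) \in A by rewrite /n; case: ex_minnP.
have before i c : c < n i -> iter c f (y i) \notin A.
  by rewrite /n; case: ex_minnP => N _ min lt; apply: contraL lt => /min; rewrite -leqNgt.
pose back i m := [seq iter c f (y i) | c <- rev (iota 0 m)].
have backS i m : back i m.+1 = iter m f (y i) :: back i m.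
  by rewrite /back -addn1 iotaD rev_cat.
have mem_back i m u : reflect (exists2 c, c < m & u = iter c f (y i)) (u \in back i m).
  apply: (iffP mapP) => -[c]; first by rewrite mem_rev mem_iota => cm ->; exists c.
  by move=> cm ->; exists c; rewrite // mem_rev mem_iota.
have uniq_back i m : m <= (n i).+1 -> uniq (back i m).
  move=> le_m; rewrite map_inj_in_uniq ?rev_uniq ?iota_uniq // => a b.
  rewrite !mem_rev !mem_iota => /= am bm /meet[] // c lt; apply: before; lia.
exists (fun i => iter (n i) f (y i)), (fun i => back i (n i)).
split=> // [i|i j ij].
  have walk m : m <= n i ->
      path e (iter m f (y i)) (back i m) && (last (iter m f (y i)) (back i m) == y i).
    elim: m => [|m IHm] m_lt; first by rewrite /= eqxx.
    rewrite backS /= -andbA (IHm (ltnW m_lt)) andbT.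
    have mA := before _ _ m_lt.
    have := hG (exist _ (iter m f (y i)) mA); rewrite -fE !inE /= => /andP[_ /orP[/eqP fx|//]].
    (* [G] also admits the vertex itself as predecessor; here that would identify iterates [m.+1]
       and [m], against [meet]. *)
    case: (@meet m.+1 m i i) => //; last by move=> _; lia.
      by move=> c lt; apply: before; lia.
    by move=> c lt; apply: before; lia.
  by rewrite /dipath -backS uniq_back // andbT; apply: walk.
rewrite -!backS; apply/pred0P => u /=; apply/negP => /andP[/mem_back[a la ->] /mem_back[b lb]].
case/meet=> [c lt|c lt|ij' _]; [apply: before; lia|apply: before; lia|].
by rewrite ij' eqxx in ij.
Qed.

(** * Subdivided digraphs and disjoint paths *)

Lemma mem_cat_cons (T : eqType) (x : T) (q : seq T) :
  x \in q -> exists q1 q2, q = q1 ++ x :: q2.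
Proof. by case/splitPr=> q1 q2; exists q1, q2. Qed.

Lemma has_first (T : Type) (a : pred T) (q : seq T) :
  has a q -> exists q1 x q2, [/\ q = q1 ++ x :: q2, a x & ~~ has a q1].
Proof. by case/split_find=> x q1 q2 ax Na; exists q1, x, q2; rewrite cat_rcons. Qed.

(* [L a b] lists the interior vertices of the subdivided edge from a to b. *)
Definition subdivision (T : finType) (e : rel T) (S : {set T}) (L : T -> T -> seq T) : Prop :=
  (forall a b, a \in S -> b \in S -> a != b ->
     dipath e a b (rcons (L a b) b) /\ [disjoint L a b & S]) /\
  (forall a b c d z, a \in S -> b \in S -> a != b -> c \in S -> d \in S -> c != d ->
     z \in L a b -> z \in L c d -> a = c /\ b = d).

(* Minimise the total cost of the paths, where an edge of the subdivision costs 1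
   and any other edge #|T|, more than a whole subdivided edge. *)
Lemma reroute (T : finType) (e : rel T) (S : {set T}) (L : T -> T -> seq T)
    (k : nat) (y s : 'I_k -> T) (p : 'I_k -> seq T) :
  subdivision e S L -> linkage e S y s p ->
  exists s' p', [/\ linkage e S y s' p', forall i, [disjoint p' i & S]
    & forall a b i, a \in S -> b \in S -> a != b -> (forall j, s' j != a) ->
        [disjoint L a b & s' i :: p' i]].
Proof.
case=> Lpath Ldisj.
(* [K] is generous: [u] and [v] need only lie on one subdivided edge, [u] not at its end and [v] not
   at its start, in whatever order. *)
pose K u v := [exists a in S, exists b in S,
  [&& a != b, u \in a :: L a b & v \in rcons (L a b) b]].
have [cost [cost_nil cost_cons]] : exists cost : T -> seq T -> nat,
    (forall x, cost x [::] = 0) /\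
    (forall x z q, cost x (z :: q) = (if K x z then 1 else #|T|) + cost z q).
  by exists (fix cost x q :=
    if q is z :: q' then (if K x z then 1 else #|T|) + cost z q' else 0).
have cost_cat x q1 q2 : cost x (q1 ++ q2) = cost x q1 + cost (last x q1) q2.
  by elim: q1 x => [|z q1 IHq] x /=; rewrite ?cost_nil // !cost_cons IHq addnA.
have cost_K x q : path K x q -> cost x q = size q.
  by elim: q x => [|z q IHq] x //=; rewrite cost_cons => /andP[-> /IHq ->].
have cost_lt x q : cost x q < #|T| -> path K x q.
  elim: q x => //= z q IHq x; rewrite cost_cons; case: (K x z) => lt; last first.
    by rewrite ltnNge leq_addr in lt.
  by apply: IHq; apply: leq_ltn_trans lt; apply: leq_addl.
(* A walk along [K] from [c] that avoids [S] remains inside subdivided edges leaving [c], because an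
   interior vertex determines its subdivided edge. *)
have K_walk c q x : c \in S -> [disjoint q & S] -> path K x q ->
    x = c \/ (exists b, [/\ b \in S, c != b & x \in L c b]) ->
    forall z, z \in q -> exists b, [/\ b \in S, c != b & z \in L c b].
  move=> cS; elim: q x => //= z q IHq x; rewrite disjoint_cons => /andP[zS dq].
  case/andP=> /existsP[a /andP[aS /existsP[b /andP[bS /and3P[ab xab zab]]]]] Kq xc.
  have zLab : z \in L a b.
    by move: zab; rewrite mem_rcons inE; case: eqP zS => // ->; rewrite bS.
  have ac : c = a.
    have [_ LSab] := Lpath a b aS bS ab.
    case: xc => [xc|[b' [b'S cb' xL]]].
      by move: xab; rewrite inE -xc => /orP[/eqP //|]; rewrite xc (disjointFl LSab).
    have [_ LScb] := Lpath c b' cS b'S cb'.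
    move: xab; rewrite inE => /orP[/eqP xa|xab].
      by rewrite xa (disjointFl LScb) in xL.
    by case: (Ldisj c b' a b x).
  have zc : exists b, [/\ b \in S, c != b & z \in L c b] by exists b; rewrite ac.
  move=> u; rewrite inE => /orP[/eqP -> //|uq].
  by apply: (IHq z dq Kq _ u uq); right.
have [n] := ubnP (\sum_i cost (s i) (p i)).
elim: n s p => // n IHn s p lt_n [sS dp disj].
have replace j a q : a \in S -> dipath e a (y j) q ->
    (forall i, i != j -> [disjoint a :: q & s i :: p i]) ->
    cost a q < cost (s j) (p j) -> exists s' p',
    [/\ linkage e S y s' p', forall i, [disjoint p' i & S]
    & forall a b i, a \in S -> b \in S -> a != b -> (forall j, s' j != a) ->
        [disjoint L a b & s' i :: p' i]].
  move=> aS dq disj_q lt_q.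
  apply: (IHn (fun i => if i == j then a else s i) (fun i => if i == j then q else p i)).
    rewrite -ltnS; apply: leq_trans lt_n; rewrite ltnS (bigD1 j) //= [ltnRHS](bigD1 j) //=.
    rewrite eqxx -addSn leq_add //; apply: leq_sum => i /negPf ->; exact: leqnn.
  split=> [i|i|i i' ii'].
  - by case: eqP.
  - by case: eqP => // ->.
  - case: eqP => [ij|/eqP ij]; case: eqP => [i'j|/eqP i'j].
    + by rewrite ij i'j eqxx in ii'.
    + exact: disj_q.
    + by rewrite disjoint_sym; apply: disj_q.
    + exact: disj.
(* A path meeting [S] after its start is cut to begin there. This saves the edge into that vertex,
   whose cost is positive. *)
case: (pickP (fun j => has (mem S) (p j))) => [j /hasP[b bp /= bS]|pS].
  have [p1 [p2 def_p]] := mem_cat_cons bp.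
  have := dp j; rewrite /dipath def_p cat_path last_cat /= cat_uniq /=.
  case/and3P=> /and3P[_ _ pth] lst /and5P[_ _ _ b2 unq].
  apply: (replace j b p2) => //; first by rewrite /dipath pth lst /= b2.
    move=> i ij; apply: disjointWl (disj j i _); last by rewrite eq_sym.
    by apply/subsetP => z zp; rewrite def_p inE mem_cat zp !orbT.
  rewrite def_p cost_cat cost_cons ltn_addl // -[ltnLHS]add0n ltn_add2r.
  by case: (K _ b) => //; apply: leq_trans (max_card (pred1 b)); rewrite card1.
have pjS i : [disjoint p i & S].
  by rewrite disjoint_has; apply/negbT; have := pS i; rewrite /= => <-; apply: eq_has.
case: (pickP (fun ab : T * T => [&& ab.1 \in S, ab.2 \in S, ab.1 != ab.2,
     [forall j, s j != ab.1] & has (fun z => [exists j, z \in s j :: p j]) (L ab.1 ab.2)])).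
  case=> a b /= /and5P[aS bS ab /forallP a_unused].
  have [dL LS] := Lpath a b aS bS ab.
  have a_p i : a \notin s i :: p i.
    by rewrite inE eq_sym (negPf (a_unused i)) (disjointFl (pjS i)).
  case/has_first=> l1 [z [l2 [defL /existsP[j zj] no_hit]]].
  have zL : z \in L a b by rewrite defL mem_cat inE eqxx orbT.
  have zS : z \notin S by rewrite (disjointFr LS zL).
  have {}zj : z \in p j.
    by move: zj; rewrite inE => /orP[/eqP zs|//]; rewrite zs sS in zS.
  have [p1 [p2 def_p]] := mem_cat_cons zj.
  have := dp j; rewrite /dipath def_p cat_path last_cat /= cat_uniq /=.
  case/and3P=> /and3P[pth1 ez pth] lst /and5P[_ _ _ z2 unq].
  have l1_p i u : u \in l1 -> u \notin s i :: p i.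
    by move=> ul; apply: contra no_hit => up; apply/hasP; exists u => //; apply/existsP; exists i.
  have a_l1 : path e a (l1 ++ [:: z]) /\ uniq (a :: l1 ++ [:: z]).
    have defLb : rcons (L a b) b = (l1 ++ [:: z]) ++ rcons l2 b by rewrite defL rcons_cat -catA.
    move: dL; rewrite defLb /dipath -cat_cons cat_path cat_uniq.
    by case/and3P=> /andP[-> _] _ /andP[-> _].
  have [pth_l unq_l] := a_l1.
  apply: (replace j a (l1 ++ z :: p2)) => //.
  - have def_q : l1 ++ z :: p2 = (l1 ++ [:: z]) ++ p2 by rewrite -catA.
    rewrite /dipath def_q -cat_cons cat_path cat_uniq pth_l unq_l unq !last_cat /= pth lst andbT.
    apply/hasPn => u up2; have up : u \in p j by rewrite def_p mem_cat inE up2 !orbT.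
    rewrite inE mem_cat inE !negb_or; apply/and3P; split.
    + by apply: contraTneq up => ->; have := a_p j; rewrite inE negb_or => /andP[].
    + by apply: contraL up => /(l1_p j); rewrite inE negb_or => /andP[].
    + by apply: contraNneq z2 => <-.
  - move=> i ij; rewrite disjoint_cons a_p disjoint_has; apply/hasPn => u.
    rewrite mem_cat => /orP[/l1_p -> //|up2].
    have up : u \in s j :: p j by rewrite def_p inE mem_cat up2 !orbT.
    by rewrite (disjointFr (disj j i _) up) // eq_sym.
  - have def_q : l1 ++ z :: p2 = (l1 ++ [:: z]) ++ p2 by rewrite -catA.
    have def_pj : p j = (p1 ++ [:: z]) ++ p2 by rewrite def_p -catA.
    rewrite def_q def_pj (cost_cat a) (cost_cat (s j)) !last_cat /= ltn_add2r.
    have K_L q x : x \in a :: L a b -> {subset q <= L a b} -> path K x q.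
      elim: q x => //= v q IHq x xL qL; have vL : v \in L a b by rewrite qL ?inE ?eqxx.
      rewrite IHq ?inE ?vL ?orbT // => [|u uq]; last by rewrite qL ?inE ?uq ?orbT.
      rewrite andbT; apply/existsP; exists a; rewrite aS; apply/existsP; exists b.
      by rewrite bS ab xL mem_rcons inE vL orbT.
    have Kl : path K a (l1 ++ [:: z]).
      apply: K_L; rewrite ?mem_head // => u; rewrite defL !mem_cat !inE.
      by case/orP=> ->; rewrite ?orbT.
    rewrite (cost_K _ _ Kl).
    have lt_size : size (l1 ++ [:: z]) < #|T|.
      by have := max_card (mem (a :: l1 ++ [:: z])); rewrite (card_uniqP unq_l).
    rewrite ltnNge; apply/negP => le_cost.
    have /K_walk Kp := cost_lt _ _ (leq_ltn_trans le_cost lt_size).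
    have [||||b' [b'S sb' zLb']] := Kp (s j) _ _ _ z.
    + exact: sS.
    + by apply: disjointWl (pjS j); apply/subsetP => u;
        rewrite def_pj [in X in _ -> X]mem_cat => ->.
    + by left.
    + by rewrite mem_cat inE eqxx orbT.
    have [sja _] := Ldisj _ _ _ _ _ (sS j) b'S sb' aS bS ab zLb' zL.
    by have := a_unused j; rewrite sja eqxx.
move=> all_ok; exists s, p; split=> // a b i aS bS ab a_unused.
rewrite disjoint_has; have /= := all_ok (a, b); rewrite aS bS ab /=.
have -> : [forall j, s j != a] by apply/forallP.
move/negbT; apply: contra => /hasP[u uL us]; apply/hasP; exists u => //.
by apply/existsP; exists i.
Qed.

(** The lists are chosen one at a time; [F] collects [F0] and the lists already chosen, so it never
    outgrows [#|F0| + s * size js]. *)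
Lemma greedy_disjoint (J : eqType) (T : finType) (Q : J -> seq T -> Prop)
    (s B : nat) (F0 : {set T}) (js : seq J) :
  (forall (F : {set T}) j, j \in js -> F0 \subset F -> #|F| <= B ->
     exists l, [/\ Q j l, size l <= s & [disjoint l & F]]) ->
  uniq js -> #|F0| + s * size js <= B ->
  exists l : J -> seq T,
    [/\ forall j, j \in js -> [/\ Q j (l j), size (l j) <= s & [disjoint l j & F0]]
      & forall i j, i \in js -> j \in js -> i != j -> [disjoint l i & l j]].
Proof.
move=> step; elim: js step => [|j js IHjs] step /= => [_ _|/andP[jNjs uniq_js] leB].
  by exists (fun=> [::]).
have [|//||l [lQ ldisj]] := IHjs.
- by move=> F i ijs; apply: step; rewrite inE ijs orbT.
- by apply: leq_trans leB; rewrite leq_add2l leq_mul2l leqnSn orbT.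
pose F := F0 :|: [set x in flatten (map l js)].
have leF : #|F| <= B.
  apply: leq_trans leB; apply: leq_trans (leq_card_setU _ _) _; rewrite leq_add2l.
  rewrite cardsE (leq_trans (card_size _)) // size_flatten /shape -map_comp.
  apply: leq_trans (_ : s * size js <= _); last by rewrite leq_mul2l leqnSn orbT.
  elim: (js) (fun i ijs => lQ i ijs) => //= i r IHr /= lr; rewrite mulnS leq_add //.
    by have [] := lr i (mem_head _ _).
  by apply: IHr => i' i'r; apply: lr; rewrite inE i'r orbT.
have [l0 [Q0 size0 disj0]] := step F j (mem_head _ _) (subsetUl _ _) leF.
have l0_l i : i \in js -> [disjoint l0 & l i].
  move=> ijs; apply: disjointWr disj0; apply/subsetP => x xl; rewrite !inE.
  by apply/orP; right; apply/flattenP; exists (l i); rewrite ?map_f.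
exists (fun i => if i == j then l0 else l i); split=> [i|i i'].
  rewrite inE; case: eqP => [-> _|_ /lQ //]; split=> //.
  by apply: disjointWr disj0; apply: subsetUl.
rewrite !inE; case: eqP => [->|_]; case: eqP => [->|_] //=.
- by rewrite eqxx.
- by move=> _ i'js _; apply: l0_l.
- by move=> ijs _ _; rewrite disjoint_sym; apply: l0_l.
- by move=> ijs i'js ii'; apply: ldisj.
Qed.

(** * Domination in tournaments *)

Lemma tournament_converse (T : finType) (e : rel T) :
  tournament e -> tournament (fun x y => e y x).
Proof. by case=> irr e_tot; split=> // x y; rewrite addbC; apply: e_tot. Qed.

Lemma tournament_nedge (T : finType) (e : rel T) x y :
  tournament e -> x != y -> ~~ e x y = e y x.
Proof. by case=> _ e_tot /e_tot; case: (e x y) => // /negPf ->. Qed.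

(** Double counting: inside [P] the in-degrees and the out-degrees have the same sum, and the two
    add up to [#|P|.-1] at each vertex, so some in-degree reaches half of that. *)
Lemma tournament_max_indegree (T : finType) (e : rel T) (P : {set T}) :
  tournament e -> P != set0 ->
  exists2 x, x \in P & #|P| <= (2 * #|[set y in P | e y x]|).+1.
Proof.
move=> eT /set0Pn[x0 x0P]; pose din x := #|[set y in P | e y x]|.
pose dout x := #|[set y in P | e x y]|.
have sum_din : \sum_(x in P) din x = \sum_(x in P) dout x.
  rewrite (eq_bigr (fun x => \sum_(y in P) if e y x then 1 else 0)) => [|x _].
    rewrite exchange_big; apply: eq_bigr => x _; rewrite -big_mkcondr sum1dep_card.
    by [].
  by rewrite -big_mkcondr sum1dep_card.
have din_dout x : x \in P -> din x + dout x = #|P|.-1.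
  move=> xP; rewrite [in RHS](cardsD1 x) xP /din /dout -cardsUI.
  set I := _ :&: _; have -> : I = set0.
    apply/setP => y; rewrite !inE; case: (y \in P) => //=.
    have [->|xy] := eqVneq x y; first by case: eT => ->.
    by rewrite -(tournament_nedge eT xy) andNb.
  rewrite cards0 addn0; apply: eq_card => y; rewrite !inE.
  have [->|xy] := eqVneq y x; first by case: eT => ->; rewrite andbF.
  by rewrite -(tournament_nedge eT xy); case: (y \in P); case: (e y x).
case: (pickP (fun x => (x \in P) && (#|P| <= (2 * din x).+1))) => [x /andP[]|noP].
  by exists x.
have : \sum_(x in P) #|P|.-1 = \sum_(x in P) (2 * din x).
  rewrite (eq_bigr (fun x => din x + dout x)) => [|x /din_dout //].
  by rewrite big_split -sum_din -big_distrr /= mul2n addnn.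
have : \sum_(x in P) (2 * din x).+1 <= \sum_(x in P) #|P|.-1.
  apply: leq_sum => x xP; have := noP x; rewrite xP /= => /negbT.
  by rewrite -ltnNge => lt; rewrite -ltnS (leq_trans lt) // leqSpred.
rewrite (eq_bigr (fun x => 2 * din x + 1)) => [|x _]; last by rewrite addn1.
rewrite big_split /= sum1_card => le1 eq1; move: le1; rewrite eq1.
by rewrite -[leqRHS]addn0 leq_add2l leqn0 cards_eq0 => /eqP P0; rewrite P0 inE in x0P.
Qed.

Lemma tournament_few_low_indegree (T : finType) (e : rel T) (P : {set T}) (d : nat) :
  tournament e -> (forall x, x \in P -> #|[set y in P | e y x]| < d) -> #|P| <= 2 * d.
Proof.
move=> eT lowP; have [->|/(tournament_max_indegree eT)[x /lowP]] := eqVneq P set0.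
  by rewrite cards0.
lia.
Qed.

(** Greedy halving: a vertex [t] of large in-degree serves itself and its in-neighbours, and its
    out-neighbours make up less than half of [G]. *)
Lemma tournament_dominating (T : finType) (e : rel T) (p : nat) (G : {set T}) :
  tournament e -> #|G| < 2 ^ p ->
  exists S : {set T}, [/\ S \subset G, #|S| <= p
    & forall g, g \in G -> g \notin S -> exists2 t, t \in S & e g t].
Proof.
move=> eT; elim: p G => [|p IHp] G ltG.
  exists set0; split; rewrite ?sub0set ?cards0 // => g.
  by move: ltG; rewrite ltnS leqn0 cards_eq0 => /eqP ->; rewrite inE.
have [->|/(tournament_max_indegree eT)[t tG le_t]] := eqVneq G set0.
  by exists set0; split; rewrite ?sub0set ?cards0 // => g; rewrite inE.
have [|S [SG leS domS]] := IHp [set y in G | e t y].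
  have : #|[set y in G | e y t]| + #|[set y in G | e t y]| < #|G|.
    rewrite [ltnRHS](cardsD1 t) tG ltnS -cardsUI.
    set I := _ :&: _; have -> : I = set0.
      apply/setP => y; rewrite !inE; case: (y \in G) => //=.
      have [->|yt] := eqVneq y t; first by case: eT => ->.
      by rewrite -(tournament_nedge eT yt) andbN.
    rewrite cards0 addn0 subset_leq_card //; apply/subsetP => y; rewrite !inE.
    have [->|yt] := eqVneq y t; first by case: eT => ->; rewrite andbF.
    by case/orP=> /andP[->].
  by move: ltG le_t; rewrite expnS; lia.
exists (t |: S); split.
- apply/subsetP => y; rewrite !inE => /orP[/eqP -> //|/(subsetP SG)].
  by rewrite inE => /andP[].
- by rewrite cardsU1; case: (_ \in _) => /=; rewrite ?add1n ?add0n ?ltnS // ltnW.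
move=> g gG; rewrite !inE => /norP[gt gS]; have [gt_e|tg_e] := boolP (e g t).
  by exists t; rewrite ?inE ?eqxx.
have [|u uS gu] := domS g _ gS; last by exists u; rewrite ?inE ?uS ?orbT.
by rewrite inE gG -(tournament_nedge eT gt).
Qed.

(** Each of [q] rounds treats what the earlier rounds left of [G], so it gives every remaining
    vertex one more out-neighbour. *)
Lemma tournament_multidominating (T : finType) (e : rel T) (p q : nat) (G : {set T}) :
  tournament e -> #|G| < 2 ^ p ->
  exists S : {set T}, [/\ S \subset G, #|S| <= q * p
    & forall g, g \in G -> g \notin S -> q <= #|[set t in S | e g t]|].
Proof.
move=> eT ltG; elim: q => [|q [S [SG leS domS]]].
  by exists set0; rewrite sub0set cards0.
have [|S' [S'G leS' domS']] := @tournament_dominating T e p (G :\: S) eT.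
  by apply: leq_ltn_trans ltG; rewrite subset_leq_card // subsetDl.
exists (S :|: S'); split.
- by rewrite subUset SG (subset_trans S'G) ?subsetDl.
- by rewrite mulSn addnC (leq_trans (leq_card_setU _ _)) // leq_add.
move=> g gG; rewrite inE => /norP[gS gS'].
have [|t tS' gt] := domS' g _ gS'; first by rewrite inE gS.
have tS : t \notin S by have := subsetP S'G t tS'; rewrite inE => /andP[].
rewrite (cardsD1 t) !inE tS' gt orbT ltnS (leq_trans (domS g gG gS)) //.
apply: subset_leq_card; apply/subsetP => u; rewrite !inE => /andP[uS ->].
by rewrite uS !andbT; apply: contraNneq tS => <-.
Qed.

Lemma lowest_values (T : finType) (g : T -> nat) (m : nat) :
  m <= #|T| ->
  exists2 v : 'I_m -> T, injective v & forall u, u \notin codom v -> forall c, g (v c) <= g u.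
Proof.
move=> le_m; have [V cardV lowV] : exists2 V : {set T}, #|V| = m &
    forall v u, v \in V -> u \notin V -> g v <= g u.
  elim: m le_m => [_|m IHm ltm]; first by exists set0; rewrite ?cards0 // => v u; rewrite inE.
  have [V cardV lowV] := IHm (ltnW ltm).
  have /card_gt0P[u0 u0V] : 0 < #|~: V| by rewrite cardsCs setCK cardV subn_gt0.
  case: (arg_minnP g u0V) => u uVC min_u.
  have uV : u \notin V by rewrite -in_setC.
  exists (u |: V).
    by rewrite cardsU1 cardV uV.
  move=> v w; rewrite !inE negb_or => /orP[/eqP ->|vV] /andP[wu wV].
    by apply: min_u; rewrite -in_setC in wV.
  exact: lowV.
exists (fun c => enum_val (cast_ord (esym cardV) c)) => [c d|u uV c].
  by move/enum_val_inj/cast_ord_inj.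
apply: lowV; first exact: enum_valP.
apply: contra uV => uV; apply/codomP; exists (cast_ord cardV (enum_rank_in uV u)).
by rewrite cast_ordK enum_rankK_in.
Qed.

(** * The hub *)

(* The v c are the m vertices of lowest out-degree. The vertices z escaping the
   common out-neighbourhood of a pair (v c, w c) send an edge into the pair, and
   either member of the pair dominates all the t (c, r). *)
Lemma gates (T : finType) (e : rel T) (x0 : T) (m R Q : nat) :
  tournament e -> (forall x, m + 2 * (m * R) + 2 * Q.+1 <= outdegree e x) ->
  exists (v w : 'I_m -> T) (t : 'I_m * 'I_R -> T),
    [/\ injective v, injective w, injective t,
        forall j, e (v j.1) (t j) && e (w j.1) (t j)
      & forall u c, u \notin codom v ->
          Q < #|[set z | e u z && ~~ (e (v c) z && e (w c) z)]|].
Proof.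
move=> eT deg; pose D x := [set z | e x z].
have [|v inj_v low_v] := @lowest_values T (outdegree e) m.
  by apply: leq_trans (max_card (D x0)); apply: leq_trans (deg x0); lia.
pose Dout x z := [set y in D x | e z y]; pose Din x z := [set y in D x | e y z].
(* At most [2 * (m * R) + 2 * Q.+1] out-neighbours of [v c] fail one of the two conditions, so at
   least [m] satisfy both, enough for distinct representatives. *)
pose mid c := [set z in D (v c) | (m * R <= #|Dout (v c) z|) && (Q < #|Din (v c) z|)].
have [c|w inj_w mid_w] := @distinct_representatives _ _ mid.
  rewrite card_ord; pose lo := [set z in D (v c) | #|Dout (v c) z| < m * R].
  pose li := [set z in D (v c) | #|Din (v c) z| < Q.+1].
  have le_lo : #|lo| <= 2 * (m * R).
    apply: (tournament_few_low_indegree (tournament_converse eT)) => z.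
    rewrite inE => /andP[_]; apply: leq_ltn_trans; apply: subset_leq_card.
    by apply/subsetP => y; rewrite !inE -!andbA => /and3P[-> _ ->].
  have le_li : #|li| <= 2 * Q.+1.
    apply: (tournament_few_low_indegree eT) => z.
    rewrite inE => /andP[_]; apply: leq_ltn_trans; apply: subset_leq_card.
    by apply/subsetP => y; rewrite !inE -!andbA => /and3P[-> _ ->].
  have : #|D (v c)| <= #|mid c| + #|lo| + #|li|.
    apply: leq_trans (leq_trans (leq_card_setU (mid c :|: lo) li) _); last first.
      by rewrite leq_add2r leq_card_setU.
    apply: subset_leq_card; apply/subsetP => z; rewrite !inE ltnS => ->.
    by rewrite !ltnNge; case: (_ <= _); case: (_ <= _).
  have := deg (v c); rewrite /outdegree -/(D (v c)); lia.
have [j|t inj_t Et] := @distinct_representatives _ _ (fun j : 'I_m * 'I_R => Dout (v j.1) (w j.1)).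
  by have := mid_w j.1; rewrite card_prod !card_ord inE => /andP[_ /andP[]].
exists v, w, t; split=> // [j|u c uv].
  by have := Et j; rewrite !inE.
(* The out-degree of [u] is at least that of [v c], which exceeds the number of common
   out-neighbours by [#|D (v c) :\: D (w c)|]. That set contains [Din (v c) (w c)], of size above
   [Q]. *)
have := mid_w c; rewrite !inE => /and3P[_ _ Qlt]; apply: leq_trans Qlt _.
have le_deg := low_v u uv c.
have : #|D (v c)| = #|Dout (v c) (w c)| + #|D (v c) :\: D (w c)|.
  by rewrite -(cardsID (D (w c))); congr (_ + _); apply: eq_card => z; rewrite !inE.
have : #|Din (v c) (w c)| <= #|D (v c) :\: D (w c)|.
  apply: subset_leq_card; apply/subsetP => z; rewrite !inE => /andP[-> zw].
  have [zw'|zw'] := eqVneq z (w c); first by move: zw; rewrite zw'; case: eT => ->.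
  by rewrite andbT -(tournament_nedge eT zw') negbK in zw *.
have := cardsID (Dout (v c) (w c)) (D u).
have : #|D u :&: Dout (v c) (w c)| <= #|Dout (v c) (w c)|.
  by rewrite subset_leq_card // subsetIr.
have -> : D u :\: Dout (v c) (w c) = [set z | e u z && ~~ (e (v c) z && e (w c) z)].
  by apply/setP => z; rewrite !inE andbC.
move: le_deg; rewrite /outdegree -/(D u) -/(D (v c)); lia.
Qed.

(** An out-neighbour [z] of [u] that is not dominated by both [v] and [w] either is one of them or
    sends an edge to one of them. *)
Lemma gate_reach (T : finType) (e : rel T) (v w u : T) (F : {set T}) :
  tournament e -> #|F| < #|[set z | e u z && ~~ (e v z && e w z)]| ->
  u != v -> v \notin F -> w \notin F ->
  exists p, [/\ path e u p, uniq (u :: p), size p <= 2, [disjoint p & F]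
              & last u p \in [:: v; w]].
Proof.
move=> eT ltF uv vF wF; have irr : irreflexive e by case: eT.
have [->|uw] := eqVneq u w.
  by exists [::]; rewrite !inE eqxx orbT /= disjoint_has.
have [z] : exists z, z \in [set z | e u z && ~~ (e v z && e w z)] :\: F.
  by apply/card_gt0P; have := cardsID F [set z | e u z && ~~ (e v z && e w z)];
     have := subset_leq_card (subsetIr [set z | e u z && ~~ (e v z && e w z)] F); lia.
rewrite !inE => /and3P[zF euz evw].
have uz : u != z by apply: contraTneq euz => ->; rewrite irr.
have via y : y != z -> ~~ e y z -> y \notin F -> u != y -> y \in [:: v; w] ->
    exists p, [/\ path e u p, uniq (u :: p), size p <= 2, [disjoint p & F]
              & last u p \in [:: v; w]].
  rewrite !inE => yz nyz yF uy yvw; exists [:: z; y].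
  rewrite /= !inE euz -(tournament_nedge eT yz) nyz negb_or uz uy eq_sym yz.
  by rewrite !disjoint_cons zF yF disjoint_has.
have [zvw|] := boolP (z \in [:: v; w]).
  by exists [:: z]; rewrite /= euz inE uz disjoint_cons zF disjoint_has.
rewrite !inE negb_or ![z == _]eq_sym => /andP[vz wz].
move: evw; rewrite negb_and => /orP[nvz|nwz].
  by apply: (via v); rewrite // !inE eqxx.
by apply: (via w); rewrite // !inE eqxx orbT.
Qed.

(* S consists of a set dominating G q times and of 2q+1 whole classes t (c, _)
   inside G, where G collects the t j of in-degree at least d among the t's. A
   vertex x outside codom v enters the pair of one of these classes. A vertex
   v c reaches each t (c, r); if most of them are not in S, then one of those is
   in G or dominates nearly all of G. *)
Lemma hub (T : finType) (e : rel T) (q p d m n : nat) (v w : 'I_m -> T)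
    (t : 'I_m * 'I_(2 * q) -> T) :
  tournament e -> injective v -> injective w -> injective t ->
  (forall j, e (v j.1) (t j) && e (w j.1) (t j)) ->
  (forall u c, u \notin codom v -> q < #|[set z | e u z && ~~ (e (v c) z && e (w c) z)]|) ->
  m * (2 * q) < 2 ^ p -> q * p + (2 * q).+1 * (2 * q) <= n ->
  3 * d + n + q + 1 < m * (2 * q) -> 2 * d + (2 * q).+1 <= m ->
  exists S : {set T}, [/\ #|S| <= n,
      forall b, b \in S -> d <= #|[set j | e (t j) b]|
    & forall x (F : {set T}), #|F| <= q -> exists l,
        [/\ path e x l, uniq (x :: l), size l <= 2, [disjoint l & F]
          & q <= #|[set y in S | e (last x l) y]|]].
Proof.
move=> eT inj_v inj_w inj_t vwt gate lt_m le_n ge_m ge_m'.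
have irr : irreflexive e by case: eT.
pose TT := t @: setT; have cardTT : #|TT| = m * (2 * q).
  by rewrite card_imset // cardsT card_prod !card_ord.
have tTT j : t j \in TT by rewrite imset_f.
pose inTT x := [set y in TT | e y x]; pose G := [set x in TT | d <= #|inTT x|].
have nonG : #|TT :\: G| <= 2 * d.
  apply: (tournament_few_low_indegree eT) => x; rewrite !inE => /andP[+ xT].
  rewrite xT -ltnNge; apply: leq_ltn_trans; apply: subset_leq_card.
  by apply/subsetP => y; rewrite !inE => /andP[/andP[_ ->] ->].
have [|Sd [SdG leSd domSd]] := @tournament_multidominating _ _ p q G eT.
  rewrite (leq_ltn_trans _ lt_m) // -cardTT subset_leq_card //.
  by apply/subsetP => x; rewrite inE => /andP[].
pose bad := [set j.1 | j in [set j | t j \notin G]].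
have le_bad : #|bad| <= 2 * d.
  apply: leq_trans nonG; apply: leq_trans (leq_imset_card _ _) _.
  rewrite -(card_imset _ inj_t); apply: subset_leq_card.
  by apply/subsetP => _ /imsetP[j jG ->]; rewrite inE in jG; rewrite in_setD jG tTT.
(* Later [F] can spoil at most [2 * q] of the pairs [(v c, w c)], so [2 * q + 1] good classes leave
   one with its pair intact. *)
have : (2 * q).+1 <= #|~: bad| by have := cardsC bad; rewrite card_ord; lia.
case/card_geqP=> sG [uniq_sG size_sG sG_good].
have tG c r : c \in sG -> t (c, r) \in G.
  move=> /sG_good; rewrite inE; apply: contraNT => tNG.
  by apply/imsetP; exists (c, r); rewrite // inE.
pose SG := t @: setX [set c in sG] setT.
pose S := Sd :|: SG.
have SsubG : S \subset G.
  rewrite subUset SdG; apply/subsetP => _ /imsetP[[c r] + ->].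
  by rewrite in_setX in_setT inE andbT => /tG.
have leS : #|S| <= n.
  apply: leq_trans le_n; apply: leq_trans (leq_card_setU _ _) _; rewrite leq_add //.
  rewrite card_imset // cardsX cardsT card_ord cardsE leq_mul2r -size_sG.
  by rewrite card_size orbT.
exists S; split=> // [b bS|x F leF].
  have := subsetP SsubG b bS; rewrite inE => /andP[_ le_d]; apply: leq_trans le_d _.
  rewrite -(card_imset _ inj_t); apply: subset_leq_card; apply/subsetP => y.
  by rewrite inE => /andP[/imsetP[j _ ->] tb]; rewrite imset_f // inE.
have rich y c : c \in sG -> (forall r, e y (t (c, r))) -> q <= #|[set z in S | e y z]|.
  move=> cs yt; apply: leq_trans (_ : #|[set t (c, r) | r : 'I_(2 * q)]| <= _).
    rewrite card_imset ?card_ord; last by move=> r r' /inj_t [].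
    by rewrite leq_pmull.
  apply: subset_leq_card; apply/subsetP => _ /imsetP[r _ ->].
  by rewrite !inE yt andbT imset_f ?orbT // !inE cs.
have richG y : y \in G -> y \notin S -> q <= #|[set z in S | e y z]|.
  move=> yG; rewrite inE negb_or => /andP[ySd _]; apply: leq_trans (domSd y yG ySd) _.
  by apply: subset_leq_card; apply/subsetP => z; rewrite !inE => /andP[-> ->].
have [|xv] := boolP (x \in codom v); last first.
  pose Fv := v @^-1: F; pose Fw := w @^-1: F.
  have leFv : #|Fv| <= q.
    rewrite -(card_imset _ inj_v) (leq_trans _ leF) // subset_leq_card //.
    by apply/subsetP => _ /imsetP[c + ->]; rewrite inE.
  have leFw : #|Fw| <= q.
    rewrite -(card_imset _ inj_w) (leq_trans _ leF) // subset_leq_card //.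
    by apply/subsetP => _ /imsetP[c + ->]; rewrite inE.
  have [c cs] : exists2 c, c \in sG & c \notin Fv :|: Fw.
    apply/hasP; rewrite -[has _ _]/(has (predC (mem (Fv :|: Fw))) sG) has_predC.
    apply/negP => /allP sF; have le_sF : #|sG| <= #|Fv :|: Fw|.
      by apply: subset_leq_card; apply/subsetP.
    have le_FvFw : #|Fv :|: Fw| <= #|Fv| + #|Fw| := leq_card_setU Fv Fw.
    by move: le_sF; rewrite (card_uniqP uniq_sG) size_sG; lia.
  rewrite !inE negb_or => /andP[vF wF].
  have [|l [pth unq sz lF lst]] := gate_reach eT (leq_ltn_trans leF (gate x c xv)) _ vF wF.
    by apply: contraNneq xv => ->; apply: codom_f.
  exists l; split=> //; apply: (rich _ c) => // r.
  have /andP[vt wt] := vwt (c, r).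
  by move: lst; rewrite !inE => /orP[] /eqP ->.
case/codomP=> c def_x.
have xt r : e x (t (c, r)) by have /andP[] := vwt (c, r); rewrite /= def_x.
have [xrich|] := leqP q #|[set y in S | e x y]|.
  by exists [::]; rewrite /= disjoint_has.
move=> xpoor; pose A := [set r | t (c, r) \in S]; pose B := [set r | t (c, r) \in F].
have inj_tc : injective (fun r => t (c, r)) by move=> r r' /inj_t [].
have ltA : #|A| < q.
  apply: leq_ltn_trans xpoor; rewrite -(card_imset _ inj_tc) subset_leq_card //.
  by apply/subsetP => _ /imsetP[r rA ->]; rewrite inE in rA; rewrite inE rA xt.
have leB : #|B| <= q.
  apply: leq_trans leF; rewrite -(card_imset _ inj_tc) subset_leq_card //.
  by apply/subsetP => _ /imsetP[r rA ->]; rewrite inE in rA.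
have /card_gt0P[r] : 0 < #|~: (A :|: B)|.
  have leAB : #|A :|: B| <= #|A| + #|B| := leq_card_setU A B.
  by have := cardsC (A :|: B); rewrite card_ord; lia.
rewrite in_setC in_setU negb_or => /andP[rA rB]; pose y := t (c, r).
have yS : y \notin S by apply: contra rA => yS; rewrite inE.
have yF : y \notin F by apply: contra rB => yF; rewrite inE.
have xy : x != y by apply: contraTneq (xt r) => ->; rewrite irr.
have [yG|yG] := boolP (y \in G).
  exists [:: y]; rewrite /= xt inE xy disjoint_cons yF disjoint_has.
  by split=> //; apply: richG.
have lowy : #|inTT y| < d by move: yG; rewrite inE tTT /= -ltnNge.
clearbody S G.
(* The excluded set has at most [(d - 1) + 2 * d + n + q + 2] elements, fewer than [TT]. So [y]
   dominates some [z] of [G] outside [S] and [F]. *)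
have [z] : exists z, z \in TT :\: (inTT y :|: (TT :\: G) :|: S :|: F :|: [set x; y]).
  apply/card_gt0P; set H := (_ :|: [set x; y]).
  have cU (X Y : {set T}) : #|X :|: Y| <= #|X| + #|Y| := leq_card_setU X Y.
  have := cU (inTT y) (TT :\: G); have := cU (inTT y :|: (TT :\: G)) S.
  have := cU (inTT y :|: (TT :\: G) :|: S) F.
  have := cU (inTT y :|: (TT :\: G) :|: S :|: F) [set x; y]; rewrite -/H.
  have : #|[set x; y]| <= 2 by rewrite cards2; case: (_ != _).
  have := cardsID H TT; have := subset_leq_card (subsetIr TT H).
  by rewrite cardTT; lia.
rewrite !inE !negb_or => /andP[/and3P[/andP[/andP[/andP[zy zG] zS] zF] zx zy'] zTT].
rewrite zTT /= (tournament_nedge eT zy') in zy; rewrite zTT andbT negbK in zG.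
exists [:: y; z]; rewrite /= xt zy !inE negb_or xy eq_sym zx eq_sym zy' !disjoint_cons yF zF.
by rewrite disjoint_has; split=> //; apply: richG.
Qed.

(* A subdivided edge has the form a -> u -> z -> {v c, w c} -> t (c, r) -> b. *)
Lemma gate_subdivision (T : finType) (e : rel T) (m R B : nat) (v w : 'I_m -> T)
    (t : 'I_m * 'I_R -> T) (S : {set T}) :
  tournament e -> injective v -> injective w -> injective t ->
  (forall j, e (v j.1) (t j) && e (w j.1) (t j)) ->
  (forall u c, u \notin codom v -> B.+1 < #|[set z | e u z && ~~ (e (v c) z && e (w c) z)]|) ->
  (forall x, B + m + 1 < outdegree e x) ->
  #|S| + 4 * (#|S| * #|S|) <= B ->
  (forall b, b \in S -> (2 * R).+1 * B < #|[set j | e (t j) b]|) ->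
  exists L, subdivision e S L.
Proof.
move=> eT inj_v inj_w inj_t vwt gate deg le_B indeg.
have irr : irreflexive e by case: eT.
(* The guard lets all pairs of [S] serve as indices; the diagonal ones receive the empty list. *)
pose Q (ab : T * T) l := ab.1 != ab.2 -> dipath e ab.1 ab.2 (rcons l ab.2).
pose pairs := [seq (a, b) | a <- enum S, b <- enum S].
have mem_pairs a b : ((a, b) \in pairs) = (a \in S) && (b \in S).
  by rewrite -!(mem_enum S); apply/allpairsP/andP => [[[a' b'] [? ? [-> ->]]] | []] //;
    exists (a, b).
have [||| l [lQ ldisj]] := @greedy_disjoint _ _ Q 4 B S pairs.
- move=> F [a b]; rewrite mem_pairs => /andP[aS bS] SF leF; rewrite /Q /=.
  have [->|ab] := eqVneq a b; first by exists [::]; rewrite disjoint_has.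
  have aF : a \in F by apply: (subsetP SF).
  have bF : b \in F by apply: (subsetP SF).
  pose hit (u : 'I_m -> T) := setX (u @^-1: F) [set: 'I_R].
  have le_hit u : injective u -> #|hit u| <= B * R.
    move=> inj_u; rewrite cardsX cardsT card_ord leq_mul2r; apply/orP; right.
    rewrite -(card_imset _ inj_u) (leq_trans _ leF) // subset_leq_card //.
    by apply/subsetP => _ /imsetP[c + ->]; rewrite inE.
  have le_t : #|t @^-1: F| <= B.
    rewrite -(card_imset _ inj_t) (leq_trans _ leF) // subset_leq_card //.
    by apply/subsetP => _ /imsetP[c + ->]; rewrite inE.
  (* Each forbidden [v c] or [w c] excludes [R] indices and each forbidden [t j] one, at most
     [(2 * R).+1 * B] in all. *)
  have [[c r]] : exists j, j \in [set j | e (t j) b] :\: (t @^-1: F :|: hit v :|: hit w).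
    apply/card_gt0P; set H := _ :|: hit w.
    have cU (X Y : {set 'I_m * 'I_R}) : #|X :|: Y| <= #|X| + #|Y| := leq_card_setU X Y.
    have := cU (t @^-1: F) (hit v); have := cU (t @^-1: F :|: hit v) (hit w); rewrite -/H.
    have := le_hit v inj_v; have := le_hit w inj_w; have := indeg b bS.
    have := cardsID H [set j | e (t j) b].
    have := subset_leq_card (subsetIr [set j | e (t j) b] H).
    move: le_t; rewrite mulSn -mulnA [R * B]mulnC.
    by move: #|H| #|hit v| #|hit w| #|t @^-1: F| #|_ :&: H| #|_ :\: H|
      #|t @^-1: F :|: _| #|[set j | _]| => *; lia.
  rewrite !inE !andbT !negb_or => /andP[/andP[/andP[tF vF] wF] tb].
  set y := t (c, r) in tF tb; have /andP[/= vy wy] := vwt (c, r).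
  have vNy : v c != y by apply: contraTneq vy => ->; rewrite irr.
  have wNy : w c != y by apply: contraTneq wy => ->; rewrite irr.
  have [u] : exists u, u \in [set u | e a u] :\: (y |: F :|: [set z in codom v]).
    apply/card_gt0P; set H := _ :|: [set z in _].
    have : #|H| <= #|y |: F| + m.
      apply: leq_trans (leq_card_setU _ _) _; rewrite leq_add2l cardsE.
      by apply: leq_trans (card_size _) _; rewrite size_codom card_ord.
    have : #|y |: F| <= B.+1 by rewrite cardsU1 tF ltnS.
    have := cardsID H [set u | e a u]; have := deg a; rewrite /outdegree.
    have := subset_leq_card (subsetIr [set u | e a u] H).
    by clear; move: #|H| #|_ :&: H| #|_ :\: H| #|[set u | _]| #|y |: F|; lia.
  rewrite !inE !negb_or => /andP[/andP[/andP[uy uF] uv] au].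
  have leyF : #|y |: F| <= B.+1 by rewrite cardsU1 tF ltnS.
  have [|||l [pth unq sz ldisj lst]] :=
      gate_reach (v := v c) (w := w c) eT (leq_ltn_trans leyF (gate u c uv)).
  + by apply: contraNneq uv => ->; apply: codom_f.
  + by rewrite !inE negb_or vNy.
  + by rewrite !inE negb_or wNy.
  have lF z : z \in rcons (u :: l) y -> z \notin F.
    rewrite mem_rcons !inE => /or3P[/eqP ->|/eqP ->|zl] //.
    by have := disjointFr ldisj zl; rewrite !inE => /norP[_ ->].
  have ly : y \notin l.
    by apply/negP => yl; have := disjointFr ldisj yl; rewrite !inE eqxx.
  exists (rcons (u :: l) y); split; last by rewrite disjoint_has; apply/hasPn.
    have aN : a \notin rcons (rcons (u :: l) y) b.
      by rewrite mem_rcons inE (negPf ab) /=; apply: contraL aF => /lF.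
    have bN : b \notin rcons (u :: l) y by apply: contraL bF => /lF.
    have yN : y \notin u :: l by rewrite inE eq_sym negb_or uy.
    move=> _; rewrite /dipath last_rcons eqxx cons_uniq aN 2!rcons_uniq bN yN unq !andbT.
    rewrite rcons_path last_rcons tb andbT rcons_path /= au pth /=.
    by move: lst; rewrite !inE => /orP[] /eqP ->.
  by rewrite size_rcons /=.
- by rewrite allpairs_uniq ?enum_uniq // => -[a b] [a' b'] _ _ [-> ->].
- by rewrite size_allpairs -cardE.
exists (fun a b => l (a, b)); split=> [a b aS bS ab|a b c d z aS bS ab cS dS cd zab zcd].
  by have [|/(_ ab)] := lQ (a, b); rewrite ?mem_pairs ?aS.
have [[-> ->] //|neq] := eqVneq (a, b) (c, d).
have := ldisj (a, b) (c, d); rewrite !mem_pairs aS bS cS dS => /(_ isT isT neq).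
by move/disjointFr/(_ zab); rewrite zcd.
Qed.

(** Needed because [hub] asks for [m * (2 * q) < 2 ^ p] while [m] will be quadratic in [p.+1]. With
    [n = 16 * A] and [p = 2 * n], [p.+1 * p.+1] is at most [16 * 2 ^ n], and [n < 2 ^ n]. *)
Lemma quadratic_lt_exp (A : nat) : exists p, A * (p.+1 * p.+1) < 2 ^ p.
Proof.
have sq n : n.+1 * n.+1 <= 4 * 2 ^ n.
  elim: n => [|n IHn] //; case: n IHn => [|[|n]] // IHn.
  rewrite expnS mulnCA; apply: leq_trans (leq_mul (leqnn 2) IHn); lia.
exists (2 * (16 * A)); set n := 16 * A; have := ltn_expl n (ltnSn 1); have := sq n.
rewrite mul2n -addnn expnD; move: (2 ^ n) => E le_sq lt_n.
apply: (@leq_ltn_trans (A * (16 * E))); last first.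
  by rewrite mulnA [A * 16]mulnC ltn_mul2r lt_n (leq_ltn_trans _ lt_n).
rewrite leq_mul2l; apply/orP; right; apply: (@leq_trans ((2 * n.+1) * (2 * n.+1))).
  by apply: leq_mul; lia.
by rewrite mulnACA; lia.
Qed.

(** [x] itself may belong to [F], so that [F] can contain all the prescribed ends. *)
Definition hub_entry (T : finType) (e : rel T) (S : {set T}) (q : nat) : Prop :=
  forall x (F : {set T}), #|F| <= q -> exists l,
    [/\ path e x l, uniq (x :: l), size l <= 2, [disjoint l & F]
      & q <= #|[set y in S | e (last x l) y]|].

(** The bound [n] on [#|S|] is linear in [P], hence [B], which bounds [#|S| + 4 * (#|S| * #|S|)],
    and the in-degree [d] needed for it are quadratic in [P], and so is [m]. As the factor [A]
    depends on [q] only, [p] can be chosen from it without circularity. *)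
Lemma subdivided_hub (q : nat) :
  0 < q -> exists f, forall (T : finType) (e : rel T), 0 < #|T| -> tournament e ->
    (forall x, f <= outdegree e x) ->
    exists S L, subdivision e S L /\ hub_entry e S q.
Proof.
move=> q_gt0; pose a := q + (2 * q).+1 * (2 * q) + 1.
pose A := 15 * (4 * q).+1 * (a * a) + 3 + a + 3 * q + 5.
have [p lt_p] := quadratic_lt_exp (A * (2 * q)).
pose P := p.+1; pose n := a * P; pose B := 5 * (a * a) * (P * P).
pose d := ((2 * (2 * q)).+1 * B).+1; pose m := A * (P * P).
pose Q := B + q + 1.
exists (m + 2 * (m * (2 * q)) + 2 * Q.+1 + (B + m + 2)) => T e T_gt0 eT deg.
have /card_gt0P[x0 _] := T_gt0.
have [|v [w [t [inj_v inj_w inj_t vwt gate]]]] := @gates T e x0 m (2 * q) Q eT.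
  by move=> x; apply: leq_trans (deg x); apply: leq_addr.
have PP_gt0 : 0 < P * P by rewrite muln_gt0.
have leP : P <= P * P by rewrite leq_pmull.
have nn : n <= n * n by rewrite leq_pmull // muln_gt0 andbT /a addn1.
have BE : B = 5 * (n * n) by rewrite /B /n -!mulnA; congr (_ * _); rewrite mulnCA !mulnA.
have arith x b c r y : 0 < y -> r <= b * y -> x * y + 3 + r + c + 2 <= (x + 3 + b + c + 5) * y.
  by move=> y_gt0; have := leq_pmulr c y_gt0; rewrite !mulnDl; lia.
have le_m : 3 * d + n + 3 * q + 2 <= m.
  have dE : 3 * d = 15 * (4 * q).+1 * (a * a) * (P * P) + 3.
    by rewrite /d /B mulnA; move: (a * a) (P * P) => X Y; lia.
  have le_n : n <= a * (P * P) by rewrite leq_mul2l leP orbT.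
  by rewrite dE /m /A; apply: arith.
have le_mq : m <= m * (2 * q) by rewrite leq_pmulr // muln_gt0.
have [|||||S [leS indeg entry]] := @hub T e q p d m n v w t eT inj_v inj_w inj_t vwt.
- by move=> u c /(gate u c); apply: leq_ltn_trans; rewrite /Q addnAC leq_addl.
- by rewrite /m mulnAC.
- rewrite /n /a /P; move: (_ * (2 * q)) => Z.
  by have := leq_pmulr Z (ltn0Sn p); rewrite !mulnDl mulnS; lia.
- by lia.
- by lia.
have [||||L LS] := @gate_subdivision T e m (2 * q) B v w t S eT inj_v inj_w inj_t vwt.
- by move=> u c /(gate u c); apply: leq_ltn_trans; rewrite /Q addn1 ltnS leq_addr.
- by move=> x; apply: leq_trans (deg x); lia.
- rewrite BE; have : #|S| * #|S| <= n * n by apply: leq_mul.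
  by lia.
- by move=> b /indeg.
by exists S, L.
Qed.

(** * Linking through the hub *)

(** The entering paths fill a set [D] of at most [3 * k] vertices; with fewer than [k] more removed
    for Menger's theorem, fewer than [4 * k] are gone. They also spoil at most [3 * k] of the
    [5 * k] out-neighbours in [S]; of the [2 * k] left, at most [k] are starts [s j], and [k] remain
    for the choice of the [a i]. *)
Lemma linked_of_hub (T : finType) (e : rel T) (k : nat) (S : {set T}) (L : T -> T -> seq T) :
  strongly_mconnected (4 * k) e -> subdivision e S L -> hub_entry e S (5 * k) -> linked k e.
Proof.
move=> conn [Lpath Ldisj] entry x y inj_x inj_y xy.
have cU (X Y : {set T}) : #|X :|: Y| <= #|X| + #|Y| := leq_card_setU X Y.
have cD (X Y : {set T}) : #|X| <= #|X :\: Y| + #|Y|.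
  by rewrite -(cardsID Y X) addnC leq_add2l subset_leq_card // subsetIr.
pose ends := [set x i | i in 'I_k] :|: [set y i | i in 'I_k].
have le_ends : #|ends| <= 2 * k.
  by apply: leq_trans (cU _ _) _; rewrite !card_imset // card_ord mul2n addnn.
have [||| l [l_entry l_disj]] := @greedy_disjoint _ _ (fun i l => [/\ path e (x i) l,
    uniq (x i :: l) & 5 * k <= #|[set z in S | e (last (x i) l) z]|]) 2 (4 * k) ends (enum 'I_k).
- move=> F i _ _ leF; have [|l [? ? ? ? ?]] := entry (x i) F; last by exists l.
  by apply: leq_trans leF _; rewrite leq_mul2r orbT.
- exact: enum_uniq.
- by rewrite size_enum_ord; lia.
have {}l_entry i := l_entry i (mem_enum _ i).
have {}l_disj i j : i != j -> [disjoint l i & l j].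
  by apply: l_disj; rewrite mem_enum.
pose X i := x i :: l i; pose D := \bigcup_i [set z in X i].
have XD i z : z \in X i -> z \in D by move=> zX; apply/bigcupP; exists i; rewrite // inE.
have leD : #|D| <= 3 * k.
  have : #|D| <= \sum_(i < k) 3.
    rewrite /D; elim/big_rec2: _ => [|i n Z _ leZ]; first by rewrite cards0.
    apply: leq_trans (cU _ _) _; rewrite leq_add // cardsE (leq_trans (card_size _)) //=.
    by have [_ le2 _] := l_entry i.
  by rewrite sum_nat_const card_ord mulnC.
have ends_l z i : z \in ends -> z \notin l i.
  by have [_ _ dl] := l_entry i; move=> zE; rewrite (disjointFl dl zE).
have yD i : y i \notin D.
  apply/bigcupP => -[j _]; rewrite inE inE eq_sym (negPf (xy j i)) /= => yl.
  by have := ends_l (y i) j; rewrite yl inE [in X in X -> _]imset_f ?orbT // => /(_ isT).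
have X_disj i j : i != j -> [disjoint X i & X j].
  move=> ij; rewrite disjoint_cons disjoint_sym disjoint_cons disjoint_sym l_disj // andbT.
  rewrite inE negb_or (inj_eq inj_x) ij /= !ends_l //.
    by rewrite inE imset_f.
  by rewrite inE imset_f.
pose S' := [set a in S | (a \notin D) &&
  [forall b in S, (a != b) ==> [disjoint L a b & D]]].
have S'S a : a \in S' -> a \in S by rewrite inE => /andP[].
have S'D a : a \in S' -> a \notin D by rewrite inE => /and3P[].
have S'L a b : a \in S' -> b \in S' -> a != b -> [disjoint L a b & D].
  by rewrite !inE => /and3P[_ _ /forall_inP aL] /andP[bS _]; move: (aL b bS) => /implyP.
have leSS' : #|S :\: S'| <= 3 * k.
  (* Each [z] in [D] spoils at most one branch vertex: itself, or the start of the only subdivided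
     edge with [z] in its interior. *)
  pose owner z := if z \in S then z else
    if [pick a in S | [exists b in S, (a != b) && (z \in L a b)]] is Some a then a else z.
  apply: leq_trans leD; apply: leq_trans (leq_imset_card owner _).
  apply: subset_leq_card; apply/subsetP => a; rewrite inE => /andP[aS' aS].
  have [aD|aD] := boolP (a \in D).
    by apply/imsetP; exists a; rewrite /owner ?aS.
  move: aS'; rewrite inE aS aD /= => /forall_inPn[b bS].
  rewrite negb_imply disjoint_has negbK => /andP[ab /hasP[z zL zD]].
  apply/imsetP; exists z => //; rewrite /owner.
  have [_ LS] := Lpath a b aS bS ab; rewrite (disjointFr LS zL).
  case: pickP => [a' /andP[a'S /exists_inP[b' b'S /andP[ab' zL']]]|/(_ a)].
    by have [] := Ldisj a b a' b' z aS bS ab a'S b'S ab' zL zL'.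
  by rewrite aS /= => /exists_inP[]; exists b; rewrite // ab.
(* Isolating [D] rather than deleting it keeps the vertex type, so [menger] and [reroute] apply
   directly. *)
pose e' := [rel u z | [&& e u z, u \notin D & z \notin D]].
have e'_path u q : path e' u q -> path e u q.
  by apply: sub_path => ? ? /and3P[].
have e'_D u q : path e' u q -> [disjoint q & D].
  elim: q u => [|z q IHq] u /=; first by rewrite disjoint_has.
  by case/andP=> /and3P[_ _ zD] /IHq; rewrite disjoint_cons zD.
have path_e' u q : u \notin D -> [disjoint q & D] -> path e u q -> path e' u q.
  elim: q u => //= z q IHq u uD; rewrite disjoint_cons => /andP[zD qD] /andP[-> /IHq ->] //.
  by rewrite uD zD.
have sub' : subdivision e' S' L.
  split=> [a b aS' bS' ab|a b c d z /S'S aS /S'S bS ab /S'S cS /S'S dS]; last exact: Ldisj.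
  have [/and3P[pth lst unq] LS] := Lpath a b (S'S a aS') (S'S b bS') ab; split.
    rewrite /dipath lst unq andbT path_e' ?S'D //.
    rewrite disjoint_has; apply/hasPn => z; rewrite mem_rcons inE => /orP[/eqP ->|zL].
      exact: S'D.
    by rewrite (disjointFr (S'L a b aS' bS' ab) zL).
  by apply: disjointWr LS; apply/subsetP.
have le_rich i : 2 * k <= #|[set z in S' | e (last (x i) (l i)) z]|.
  have [[_ _ le5] _ _] := l_entry i.
  have := cD [set z in S | e (last (x i) (l i)) z] (S :\: S').
  have : #|[set z in S | e (last (x i) (l i)) z] :\: (S :\: S')| <=
         #|[set z in S' | e (last (x i) (l i)) z]|.
    apply: subset_leq_card; apply/subsetP => z; rewrite !in_set => /andP[zSS' /andP[zS ->]].
    by move: zSS'; rewrite zS andbT negbK => ->.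
  by lia.
have [//|Z ltZ|s0 [p0 link0]] := @menger T e' S' k y.
  have k_gt0 : 0 < k by apply: leq_ltn_trans ltZ.
  have [a aS' aZ] : exists2 a, a \in S' & a \notin Z.
    apply/subsetPn; apply: contraL ltZ => /subset_leq_card le_S'Z; rewrite -leqNgt.
    apply: leq_trans le_S'Z; have := le_rich (Ordinal k_gt0).
    have : #|[set z in S' | e (last (x (Ordinal k_gt0)) (l (Ordinal k_gt0))) z]| <= #|S'|.
      by apply: subset_leq_card; apply/subsetP => z; rewrite in_set => /andP[].
    by lia.
  have [i yZ] : exists i, y i \notin Z.
    apply/existsP; rewrite -negb_forall; apply: contraL ltZ => /forallP yZ; rewrite -leqNgt.
    rewrite -[k in k <= _]card_ord -(card_imset _ inj_y) subset_leq_card //.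
    by apply/subsetP => _ /imsetP[i _ ->].
  have [ay|ay] := eqVneq a (y i).
    by exists a, [::]; rewrite /= aZ ay codom_f -ay.
  have aDZ : a \notin D :|: Z by rewrite inE negb_or S'D.
  have yDZ : y i \notin D :|: Z by rewrite inE negb_or yD.
  have [|r /and3P[pth /eqP lst _]] :=
      conn (D :|: Z) _ (exist _ a aDZ) (exist _ (y i) yDZ) ay.
    by apply: leq_ltn_trans (cU _ _) _; lia.
  pose a' : {z | z \notin D :|: Z} := exist _ a aDZ.
  exists a, (map val r); have -> : last a (map val r) = y i.
    exact: etrans (last_map val r a') (congr1 val lst).
  rewrite codom_f; split=> //.
    apply: path_e'; first exact: S'D.
      rewrite disjoint_has; apply/hasPn => _ /mapP[z _ ->].
      by have := valP z; rewrite inE negb_or => /andP[].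
    exact: etrans (@path_map _ _ val e a' r) pth.
  rewrite /= aZ; apply/allP => _ /mapP[z _ ->] /=.
  by have := valP z; rewrite !inE negb_or => /andP[].
have [s [p [[sS' dp p_disj] pS' L_p]]] := reroute sub' link0.
pose G i := [set z in S' | e (last (x i) (l i)) z] :\: [set s j | j in 'I_k].
have [i|a inj_a aG] := @distinct_representatives _ _ G.
  have := cD [set z in S' | e (last (x i) (l i)) z] [set s j | j in 'I_k].
  have : #|[set s j | j in 'I_k]| <= k by rewrite -[k in _ <= k]card_ord leq_imset_card.
  by have := le_rich i; rewrite /G card_ord; lia.
have [aS' xa as_] : [/\ forall i, a i \in S', forall i, e (last (x i) (l i)) (a i)
    & forall i j, s j != a i].
  split=> i; have := aG i; rewrite in_setD in_set => /and3P[aNs] // _ _ j.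
  by apply: contraNneq aNs => <-; rewrite imset_f.
have a_s i j : a i != s j by rewrite eq_sym.
(* The final path is [X i], [M i], [Y i] in succession; [M i] stops just before [s i], which makes
   the three pieces disjoint. *)
pose M i := a i :: L (a i) (s i); pose Y i := s i :: p i.
have [sub'_path sub'_disj] := sub'.
have dM i := sub'_path (a i) (s i) (aS' i) (sS' i) (a_s i i).
have X_avoid i (q : seq T) : [disjoint q & D] -> [disjoint X i & q].
  by rewrite disjoint_sym; apply: disjointWl; apply/subsetP => z; apply: XD.
have XY i j : [disjoint X i & Y j].
  have /and3P[pY _ _] := dp j.
  by apply: X_avoid; rewrite disjoint_cons S'D //= (e'_D _ _ pY).
have XM i j : [disjoint X i & M j].
  by apply: X_avoid; rewrite disjoint_cons S'D //= S'L.
have MY i j : [disjoint M i & Y j].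
  by rewrite disjoint_cons inE negb_or a_s (disjointFl (pS' j)) //= L_p.
have MM i j : i != j -> [disjoint M i & M j].
  move=> ij; have aij : a i != a j by rewrite (inj_eq inj_a).
  rewrite disjoint_cons inE negb_or aij (disjointFl (dM j).2) //= disjoint_sym.
  rewrite disjoint_cons (disjointFl (dM i).2) //=.
  rewrite disjoint_has; apply/hasPn => z zj; apply/negP => zi; case/eqP: aij.
  by have [] := sub'_disj _ _ _ _ z (aS' i) (sS' i) (a_s i i) (aS' j) (sS' j) (a_s j j) zi zj.
have cat_uniq_disjoint (q1 q2 : seq T) :
    uniq (q1 ++ q2) = [&& uniq q1, [disjoint q1 & q2] & uniq q2].
  by rewrite cat_uniq disjoint_sym disjoint_has.
have uniqM i : uniq (M i).
  have [/and3P[_ _]] := dM i.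
  by rewrite -rcons_cons rcons_uniq => /andP[].
exists (fun i => l i ++ M i ++ Y i); split=> [i|i j ij].
  have [[pl ul _] _ _] := l_entry i; have [/and3P[pM _ _] _] := dM i.
  have /and3P[pY lY uY] := dp i.
  apply/and3P; split.
  - rewrite cat_path pl /= xa -cat_rcons cat_path last_rcons.
    by rewrite (e'_path _ _ pM) (e'_path _ _ pY).
  - by rewrite !last_cat.
  - rewrite -cat_cons -/(X i) !cat_uniq_disjoint ul uniqM uY MY.
    by rewrite disjoint_sym disjoint_cat ![[disjoint _ & X i]]disjoint_sym XM XY.
have dcat (q1 q2 q3 : seq T) : [disjoint q1 & q2 ++ q3] = [disjoint q1 & q2] && [disjoint q1 & q3].
  by rewrite disjoint_sym disjoint_cat ![[disjoint _ & q1]]disjoint_sym.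
rewrite -!cat_cons -/(X i) -/(X j) !disjoint_cat !dcat X_disj // MM // p_disj //.
rewrite !XM !XY !MY ![[disjoint _ & X j]]disjoint_sym XM XY.
by rewrite disjoint_sym MY.
Qed.

Theorem theorem1p1 :
  forall k : nat, 0 < k ->
  exists f : nat, 0 < f /\
  forall (T : finType) (e : rel T),
    tournament e ->
    strongly_mconnected (4 * k) e ->
    f <= min_outdegree e ->
    linked k e.
Proof.
move=> k k_gt0; have [f hub_f] := subdivided_hub (leq_mul (ltn0Sn 4) k_gt0).
exists f.+1; split=> // T e eT conn le_f.
have deg x : f < outdegree e x.
  apply: leq_trans le_f _; rewrite /min_outdegree.
  elim: (index_enum T) (mem_index_enum x) => // z r IHr; rewrite inE big_cons geq_min.
  by case/orP=> [/eqP ->|/IHr ->]; rewrite ?leqnn ?orbT.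
have [T0|T_gt0] := posnP #|T|.
  by move=> x; have := max_card (pred1 (x (Ordinal k_gt0))); rewrite T0 card1.
have [|S [L [LS entry]]] := hub_f T e T_gt0 eT; first by move=> x; apply: ltnW.
exact: linked_of_hub conn LS entry.
Qed.
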